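(* Fix a positive integer $d$. Then, with at most finitely many exceptional values of $m$, the following holds: whenever $m\equiv 5$ or $7 \pmod 8$, $S\subseteq D_{2m}\setminus\{e\}$ with $|S|=2m-2$, and the non-identity element $x$ of $D_{2m}$ not in $S$ has order $m/d$, the group $D_{2m}$ has an $S$-sequencing.
   Context: $D_{2m}=\langle u,v : u^m=e=v^2,\ vu=u^{m-1}v\rangle$ is the dihedral group of order $2m$. For $S\subseteq G\setminus\{e\}$ with $|S|=k$, an $S$-sequencing of $G$ is an ordering $(g_1,\dots,g_k)$ of the elements of $S$ such that the partial products $h_0=e$, $h_i=g_1\cdots g_i$ ($1\le i\le k$) are pairwise distinct. *)

(* Defs.v *)
From mathcomp Require Import all_boot all_fingroup all_solvable.
Set Implicit Arguments. Unset Strict Implicit. Unset Printing Implicit Defensive.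

Local Open Scope group_scope.

Definition partial_prods (gT : finGroupType) (s : seq gT) : seq gT :=
  [seq (\prod_(g <- take i s) g)%g | i <- iota 0 (size s).+1].

Definition is_S_sequencing (gT : finGroupType) (S : {set gT}) (s : seq gT) : bool :=
  perm_eq s (enum S) && uniq (partial_prods s).

Definition has_S_sequencing (gT : finGroupType) (S : {set gT}) : Prop :=
  exists s : seq gT, is_S_sequencing S s.

(* Main.v *)
(* Write the elements of D_{2m} as u^z (rotations) and v u^z (reflections), with
   z mod m.  Going from a vertex with exponent a to one with exponent b
   multiplies on the right by u^(b-a) if both are of the same kind and by
   v u^(a+b) otherwise.  A sequencing of all elements but 1 and x is therefore a
   walk through 2m - 1 vertices whose steps are all the elements but 1 and x, and
   by counting it is enough that the walk meets every vertex but one and makes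
   every required step.  Replacing u by another generator of the rotations, x may
   be any prescribed u^e with gcd(e, m) = d; here e = -2d if d > 1, and
   e = -(m-1)/2 if d = 1.

   The walk zigzags outward through about half of the rotations, then climbs a
   ladder alternating between the two kinds, with consecutive exponent sums, and
   zigzags inward through the remaining reflections.  The two zigzags together
   provide the rotations, the outward one as differences of one sign pattern and
   the inward one with the opposite signs.  When d > 1 the zigzags are modified
   inside |z| <= d so that the difference -2d never occurs; the outward one is cut
   there in two, and the cut is bridged by a reflection taken out of the ladder. *)

Require Import Defs.
From mathcomp Require Import all_boot all_fingroup all_solvable.
From mathcomp Require Import order ssralg ssrnum ssrint intdiv zify.

Set Implicit Arguments. Unset Strict Implicit. Unset Printing Implicit Defensive.

(* (false, z) stands for u^z and (true, z) for v u^z. *)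
Definition step (p q : bool * int) : bool * int :=
  if p.1 == q.1 then (false, q.2 - p.2)%R else (true, p.2 + q.2)%R.

Definition covers_vertices (m : nat) (w : nat -> bool * int) (o : bool * int) :=
  forall b, exists lo : int, forall z : int, (lo <= z < lo + m)%R ->
    (b, z) != o -> exists2 i, i < m.*2.-1 & w i = (b, z).

(* The alternative z + m allows a walk with unreduced exponents to realise some
   of its steps just outside the window. *)
Definition covers_steps (m : nat) (w : nat -> bool * int) (x : int) :=
  forall b, exists lo : int, forall z : int, (lo <= z < lo + m)%R ->
    (b, z) != (false, 0)%R -> (b, z) != (false, x) ->
    exists2 i, i.+1 < m.*2.-1 &
      step (w i) (w i.+1) \in [:: (b, z); (b, z + m)%R].

(** * Walks in coordinates and the counting criterion *)

Section Criterion.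

Variables (gT : finGroupType) (u v : gT) (m : nat).
Hypotheses (m_gt0 : 0 < m) (um : (u ^+ m = 1)%g) (v2 : (v ^+ 2 = 1)%g).
Hypothesis uv : (u ^ v = u^-1)%g.
Hypothesis gen : forall g : gT, exists (b : bool) (i : nat), g = (v ^+ b * u ^+ i)%g.
Hypothesis card_gT : #|gT| = m.*2.

Local Open Scope group_scope.

Definition upow (z : int) : gT := u ^+ `|(z %% m)%Z|%N.
Definition elt (p : bool * int) : gT := v ^+ p.1 * upow p.2.

Lemma upowE (z : int) (n : nat) : (n = z %[mod m])%Z -> upow z = u ^+ n.
Proof. by rewrite /upow => <-; rewrite modz_nat absz_nat expg_mod. Qed.

Lemma upow_nat (z : int) : exists2 n : nat, (n = z %[mod m])%Z & upow z = u ^+ n.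
Proof.
by exists `|(z %% m)%Z|%N; rewrite // gez0_abs ?modz_mod ?modz_ge0 //; lia.
Qed.

Lemma eq_upow (y z : int) : (y = z %[mod m])%Z -> upow y = upow z.
Proof. by rewrite /upow => ->. Qed.

Lemma upowD (y z : int) : upow (y + z)%R = upow y * upow z.
Proof.
have [[a ea ->] [b eb ->]] := (upow_nat y, upow_nat z).
by rewrite -expgD; apply: upowE; rewrite PoszD -modzDm ea eb modzDm.
Qed.

Lemma upow0 : upow 0 = 1. Proof. by rewrite /upow mod0z. Qed.

Lemma upowN (z : int) : upow (- z)%R = (upow z)^-1.
Proof. by apply/eqP; rewrite eq_sym eq_invg_mul -upowD GRing.addrN upow0. Qed.

Lemma upowJ (z : int) : upow z * v = v * upow (- z)%R.
Proof. by rewrite conjgC upowN /upow conjXg uv expgVn. Qed.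

Lemma step_elt (p q : bool * int) : (elt p)^-1 * elt q = elt (step p q).
Proof.
have vv : v * v = 1 by rewrite -v2 expgS expg1.
have vV : v^-1 = v by apply/eqP; rewrite eq_invg_mul vv.
case: p q => [[] y] [[] z]; rewrite /step /elt /= ?expg1 ?expg0 ?mul1g ?invMg ?vV.
- by rewrite -mulgA (mulgA v) vv mul1g -upowN -upowD GRing.addrC.
- by rewrite -upowN upowJ GRing.opprK -mulgA -upowD.
- by rewrite mulgA -upowN upowJ GRing.opprK -mulgA -upowD.
- by rewrite -upowN -upowD GRing.addrC.
Qed.

(** The kind [b] comes before the window because the windows of the covering conditions depend on
    it. *)
Lemma elt_onto (g : gT) : exists b, forall lo : int,
  exists2 z : int, (lo <= z < lo + m)%R & g = elt (b, z).
Proof.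
have [b [i ->]] := gen g; exists b => lo.
exists (lo + ((i%:Z - lo)%R %% m)%Z)%R.
  by have := ltz_pmod (i%:Z - lo)%R (d := m); have := modz_ge0 (i%:Z - lo)%R (d := m); lia.
congr (_ * _); rewrite /= (@upowE _ i) //.
by rewrite modzDmr GRing.addrC GRing.subrK.
Qed.

(** The 2m - 2 steps cover the 2m - 2 elements of [S], and the 2m - 1 vertices cover all 2m group
    elements but one, so neither list has a repetition. *)
Lemma has_S_sequencing_of_walk (w : nat -> bool * int) (o : bool * int) (x : int)
    (S : {set gT}) :
  covers_vertices m w o -> covers_steps m w x ->
  #|S| = m.*2 - 2 -> {in S, forall g, g != 1 /\ g != upow x} ->
  has_S_sequencing S.
Proof.
move=> covV covS cardS notS.
have vertices (g : gT) : g != elt o -> exists2 i, i < m.*2.-1 & elt (w i) = g.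
  have [b] := elt_onto g; have [lo cov] := covV b => /(_ lo)[z z_lo ->] ne_o.
  have [|i lt_i <-] := cov z z_lo; last by exists i.
  by apply: contraNneq ne_o => ->.
have steps (g : gT) : g != 1 -> g != upow x ->
    exists2 i, i.+1 < m.*2.-1 & elt (step (w i) (w i.+1)) = g.
  have [b] := elt_onto g; have [lo cov] := covS b => /(_ lo)[z z_lo ->] ne1 nex.
  have [||i lt_i] := cov z z_lo.
  - by apply: contraNneq ne1 => ->; rewrite /elt /= upow0 mulg1.
  - by apply: contraNneq nex => ->; rewrite /elt /= mul1g.
  rewrite !inE => /orP[] /eqP E; exists i; rewrite // E //.
  by rewrite /elt /= (@eq_upow (z + m)%R z) // modzDr.
pose q i := elt (step (w i) (w i.+1)).
pose s := [seq q i | i <- iota 0 (m.*2 - 2)].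
exists s; apply/andP; split.
  have sz : size s <= size (enum S) by rewrite size_map size_iota -cardE cardS.
  have sub : {subset enum S <= s}.
    move=> g; rewrite mem_enum => /notS[g1 gx].
    have [i lt_i <-] := steps g g1 gx.
    by apply/map_f; rewrite mem_iota; lia.
  have [_ eqs] := uniq_min_size (enum_uniq S) sub sz.
  apply: uniq_perm (enum_uniq S) (fsym eqs).
  exact: leq_size_uniq (enum_uniq S) sub sz.
(* The partial products telescope to the vertices, translated by the inverse of the first. *)
have -> : partial_prods s =
    [seq (elt (w 0))^-1 * g | g <- [seq elt (w i) | i <- iota 0 m.*2.-1]].
  rewrite /partial_prods size_map size_iota -map_comp.
  have -> : (m.*2 - 2).+1 = m.*2.-1 by lia.
  apply/eq_in_map => i; rewrite mem_iota => lt_i /=.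
  rewrite -map_take take_iota big_map.
  have -> : minn i (m.*2 - 2) = i by lia.
  elim: i {lt_i} => [|i IH]; first by rewrite big_nil mulVg.
  by rewrite -addn1 iotaD big_cat big_seq1 /= IH /q -step_elt -mulgA mulKVg addn1.
rewrite map_inj_uniq; last exact: mulgI.
apply: (@leq_size_uniq _ (enum (predC1 (elt o)))); first exact: enum_uniq.
  move=> g; rewrite mem_enum => /vertices[i lt_i <-].
  by apply/map_f; rewrite mem_iota.
by rewrite size_map size_iota -cardE cardC1 card_gT.
Qed.

End Criterion.

(** * Generators of the rotations and of the dihedral group *)

Section Dihedral.
Local Open Scope group_scope.

(** With [r] the largest divisor of [m] prime to [t], each prime factor of [m] divides exactly one
    of [t] and [n * r], hence not their sum. *)
Lemma coprime_lift (t n m : nat) : 0 < t -> 0 < m -> coprime t n ->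
  exists2 s, s = t %[mod n] & coprime s m.
Proof.
move=> t0 m0 tn; pose r := (m`_(\pi(t)^'))%N.
have rP p : (p \in \pi(r)) = (p \in \pi(m)) && (p \notin \pi(t)).
  by rewrite pi_of_part.
exists (t + n * r)%N; first by rewrite addnC mulnC modnMDl.
apply/negPn/negP => nco.
have [p p_pr] : exists2 p, prime p & p %| gcdn (t + n * r) m.
  exists (pdiv (gcdn (t + n * r) m)); last exact: pdiv_dvd.
  by rewrite pdiv_prime // ltn_neqAle eq_sym nco gcdn_gt0 m0 orbT.
rewrite dvdn_gcd => /andP[ps pm]; have := rP p.
rewrite !mem_primes p_pr m0 pm t0 part_gt0 /= => {}rP.
have [pt|npt] := boolP (p %| t); rewrite ?pt ?(negPf npt) /= in rP.
  move: ps; rewrite dvdn_addr // Euclid_dvdM // rP orbF => pn.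
  have : p %| gcdn t n by rewrite dvdn_gcd pt.
  by rewrite (eqP tn) dvdn1 => /eqP p1; rewrite p1 in p_pr.
by move: ps; rewrite dvdn_addl ?(negPf npt) // dvdn_mull.
Qed.

(** Having equal orders, [x] and [u ^+ e] generate the same subgroup of the cyclic group; the
    exponent relating them is then lifted to one prime to [#[u]]. *)
Lemma expg_coprime_lift (gT : finGroupType) (u x : gT) (e d : nat) :
  x \in <[u]> -> (#[x] * d)%N = #[u] -> gcdn #[u] e = d ->
  exists2 s, coprime s #[u] & x = u ^+ s ^+ e.
Proof.
move=> xu xd ed.
have oe : #[u ^+ e] = #[x] by rewrite orderXgcd ed -xd mulnK // -ed gcdn_gt0 order_gt0.
have eqG : <[u ^+ e]> = <[x]>.
  by apply/eqP; rewrite (eq_subG_cyclic (cycle_cyclic u)) ?cycle_subG ?mem_cycle //; apply/eqP.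
have /cycleP[t xt] : x \in <[u ^+ e]> by rewrite eqG cycle_id.
(* Adding [#[x]] keeps the residue and makes the exponent positive, as the lift requires. *)
have co : coprime (t + #[x]) #[x].
  rewrite /coprime gcdnC gcdnDr -/(coprime _ _) -{1}oe -generator_coprime -xt.
  by rewrite /generator eqG.
have [|s st cs] := coprime_lift _ (order_gt0 u) co; first by rewrite addn_gt0 order_gt0 orbT.
exists s => //; rewrite -expgM mulnC expgM {1}xt; apply/eqP.
by rewrite eq_expg_mod_order oe st modnDr.
Qed.

Lemma dihedral_generators (m : nat) : 1 < m -> exists u v : 'D_(m.*2),
  [/\ #[u] = m, v ^+ 2 = 1, u ^ v = u^-1 &
      forall g, exists (b : bool) (i : nat), g = v ^+ b * u ^+ i].
Proof.
move=> m1; have /existsP[[u v]] := isoGrp_hom (Grp_dihedral m1).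
rewrite /= !xpair_eqE => /and4P[/eqP gen /eqP um /eqP v2 /eqP uv].
exists u, v.
have genP g : exists (b : bool) (i : nat), g = v ^+ b * u ^+ i.
  have : g \in <[v]> * <[u]>.
    rewrite -norm_joinEl; first by rewrite joingC gen inE.
    by rewrite norms_cycle uv groupV cycle_id.
  case/mulsgP=> _ _ /cycleP[j ->] /cycleP[i ->] ->; exists (odd j), i.
  by rewrite -(expg_mod j v2) modn2.
split=> //; apply/eqP; rewrite eqn_leq dvdn_leq ?order_dvdn ?um ?(ltnW m1) //=.
(* The relations only bound the order of [u] from above; the lower bound holds because two cosets of
   [<[u]>] cover 2m elements. *)
have sub : [set: 'D_(m.*2)] \subset <[u]> :|: v *: <[u]>.
  apply/subsetP=> g _; have [[] [i ->]] := genP g; rewrite inE.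
    by rewrite expg1 mem_lcoset mulKg mem_cycle orbT.
  by rewrite expg0 mul1g mem_cycle.
have := leq_trans (subset_leq_card sub) (leq_of_leqif (leq_card_setU _ _)).
rewrite card_dihedral // card_lcoset -/(#[u]); lia.
Qed.

End Dihedral.

(** * Values and differences of the two zigzags *)

Section Pieces.
Local Open Scope ring_scope.

(* -(c-1), c-1, -(c-3), c-3, ..., -2, 2, *, 0, -1, 1, -3, 3, ..., -c, c,
   -(c+1), c+1, -(c+2), c+2, ...; the value at *, index c-1, is not used. *)
Definition outward (c i : nat) : int :=
  if (i < c.-1)%N then if odd i then c%:Z - i%:Z else i%:Z + 1 - c%:Z
  else if i == c then 0
  else if (i <= c.*2.+1)%N then if odd i then i%:Z - c%:Z - 1 else c%:Z - i%:Z
  else if odd i then (i./2)%:Z else - (i./2)%:Z.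

(* Indexed from the end: as r decreases to 0 the values are
   ..., c+2, -(c+2), c+1, -(c+1), c, -(c-1), c-2, -(c-3), ..., 3, -2, 1, -1, 0,
   -3, 2, -5, 4, ..., -c, c-1. *)
Definition inward (c r : nat) : int :=
  if (r <= c)%N then if odd r then r%:Z - c%:Z - 1 else c%:Z - r%:Z - 1
  else if (r <= c.*2)%N then if odd r then c%:Z - r%:Z else r%:Z - c%:Z
  else if odd r then - (r./2.+1)%:Z else (r./2)%:Z.

Ltac eval_piece :=
  rewrite /outward /inward; repeat (case: ifP => ?; try by exfalso; lia); lia.

Ltac at_index i := exists i; split; [lia.. | eval_piece].

Lemma outward_onto (c h : nat) (z : int) : odd c -> (2 < c)%N -> (c < h)%N ->
  `|z| <= h%:Z ->
  exists i, [/\ (i < h.*2.+2)%N, i != c.-1 & outward c i = z].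
Proof.
move=> oc c2 ch hz.
have [n En] : exists n : nat, z = n%:Z \/ z = - n%:Z /\ (0 < n)%N by exists `|z|%N; lia.
have [->|nz] := eqVneq z 0; first by at_index c.
have [lt_cn|le_nc] := ltnP c n.
  by case: En; [at_index n.*2.+1 | at_index n.*2].
have [on|en] := boolP (odd n).
  by case: En; [at_index (c + n).+1 | at_index (c + n)%N].
by case: En; [at_index (c - n)%N | at_index (c - n).-1].
Qed.

Lemma inward_onto (c h : nat) (z : int) : odd c -> (2 < c)%N -> (c < h)%N ->
  `|z| <= h%:Z -> exists r, (r <= h.*2)%N /\ inward c r = z.
Proof.
move=> oc c2 ch hz.
have [n En] : exists n : nat, z = n%:Z \/ z = - n%:Z /\ (0 < n)%N by exists `|z|%N; lia.
have [lt_cn|le_nc] := ltnP c n.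
  by case: En; [at_index n.*2 | at_index n.*2.-1].
have [on|en] := boolP (odd n).
  by case: En; [at_index (c + n)%N | at_index (c - n).+1].
by case: En; [at_index (c - n).-1 | at_index (c + n)%N].
Qed.

(** Beyond 2c the outward zigzag gives the positive even and negative odd differences, the inward
    one the others. Up to 2c the outward one gives the even differences and the inward one the odd,
    except that -1 is outward and -2 inward; sign and residue mod 4 tell on which side of the centre
    they occur. *)
Lemma same_side_steps (c h : nat) (z : int) : odd c -> (2 < c)%N -> (c < h)%N ->
    z != 0 -> z != - (c.*2)%:Z -> `|z| <= (h.*2)%:Z ->
  (exists i, [/\ (i.+1 < h.*2.+2)%N, i != c.-1, i.+1 != c.-1 &
      outward c i.+1 - outward c i = z]) \/
  (exists r, (r < h.*2)%N /\ inward c r - inward c r.+1 = z).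
Proof.
move=> oc c2 ch z0 zc zh.
have [n En] : exists n : nat, z = n%:Z \/ z = - n%:Z /\ (0 < n)%N.
  by exists `|z|%N; lia.
have [on|en] := boolP (odd n).
  have [lt_n|le_n] := ltnP c.*2 n.
    by case: En => ?; [right; at_index n.-1 | left; at_index n].
  have [n1|n1] := eqVneq n 1%N.
    by case: En => ?; [right; at_index c.-1 | left; at_index c].
  have [o2|e2] := boolP (odd n./2).
    by case: En => ?; right; [at_index (c + n./2)%N | at_index (c - n./2).-1].
  by case: En => ?; right; [at_index (c - n./2).-1 | at_index (c + n./2)%N].
case: En => [?|[? ?]].
  left; have [lt_n|le_n] := ltnP c.*2 n; first by at_index n.
  by have [o2|e2] := boolP (odd n./2); [at_index (c + n./2)%N | at_index (c.-1 - n./2)%N].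
have [n2|n2] := eqVneq n 2%N; first by right; at_index c.
have [lt_n|le_n] := ltnP c.*2 n; first by right; at_index n.-1.
left; have [o2|e2] := boolP (odd n./2); first by at_index (c - n./2).-1.
by at_index (c + n./2)%N.
Qed.

End Pieces.

(** * The three walks and what they cover *)

Section Walks.
Local Open Scope ring_scope.

(* m = 4k + 1; the vertex u^(k+1) is omitted.  The ladder skips v u^(2k), which
   is the bridge at index c-1. *)
Definition walk_1mod4 (c k i : nat) : bool * int :=
  if i == c.-1 then (true, (k.*2)%:Z)
  else if (i < k.*2.+2)%N then (false, outward c i)
  else if (i < 6 * k)%N then
    if odd i then (false, (i./2.+1)%:Z)
    else (true, if (i < 4 * k)%N then (i./2)%:Z else (i./2.+1)%:Z)
  else (true, inward c (8 * k - i)).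

(* m = 4k - 1; the vertex u^-(3k-2) is omitted.  The formulas of the zigzags also
   give u^-k and v u^-k at the two ends of the ladder. *)
Definition walk_3mod4 (c k i : nat) : bool * int :=
  if i == c.-1 then (true, - (k.*2)%:Z)
  else if (i <= k.*2)%N then (false, outward c i)
  else if (i < 6 * k - 3)%N then
    if odd i then
      (true, if (i < 4 * k - 1)%N then - (i./2.+1)%:Z else - (i./2.+2)%:Z)
    else
      (false, if (i == 6 * k - 4)%N then - (i./2.+1)%:Z else - (i./2)%:Z)
  else (true, inward c (8 * k - 4 - i)).

Ltac eval_walk :=
  rewrite /walk_1mod4 /walk_3mod4 /outward /inward;
  repeat (case: ifP => ?; try by exfalso; lia); congr pair; lia.
Ltac eval_step := rewrite /step /=; congr pair; lia.
Ltac visit j := exists j; [lia | eval_walk].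

Lemma walk_1mod4_onto (c k : nat) (b : bool) (z : int) :
  odd c -> (2 < c)%N -> (c < k)%N -> - k%:Z <= z <= (3 * k)%N%:Z ->
  (b, z) != (false, k.+1%:Z) -> exists2 i, (i < 8 * k + 1)%N & walk_1mod4 c k i = (b, z).
Proof.
move=> oc c2 ck hz; rewrite xpair_eqE => ne_o.
have [le_zk|lt_kz] : z <= k%:Z \/ k%:Z < z by lia.
  case: b {ne_o}.
    have [|r [le_r <-]] := inward_onto (z := z) oc c2 ck; first lia.
    exists (8 * k - r)%N; first lia.
    by rewrite /walk_1mod4; do !(case: ifP => ?; try by exfalso; lia); congr (_, inward c _); lia.
  have [|i [lt_i ni <-]] := outward_onto (z := z) oc c2 ck; first lia.
  by exists i; [lia | rewrite /walk_1mod4 (negPf ni) lt_i].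
have [n En] : exists n : nat, z = n%:Z by exists `|z|%N; lia.
case: b ne_o => /= ne_o; last by visit n.*2.-1.
have [En2|n2] := eqVneq n k.*2; first by visit c.-1.
by have [lt_n|le_n] := ltnP n k.*2; [visit n.*2 | visit (n.-1).*2].
Qed.

Lemma walk_1mod4_steps (c k : nat) (b : bool) (z : int) :
  odd c -> (2 < c)%N -> (c < k)%N ->
  (if b then (k.*2)%:Z <= z <= (6 * k)%N%:Z else - (k.*2)%:Z <= z <= (k.*2)%:Z) ->
  (b, z) != (false, 0) -> (b, z) != (false, - (c.*2)%:Z) ->
  exists2 i, (i.+1 < 8 * k + 1)%N & step (walk_1mod4 c k i) (walk_1mod4 c k i.+1) = (b, z).
Proof.
move=> oc c2 ck; case: b => hz; rewrite !xpair_eqE /= => z0 zc.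
  have step_at i p q : walk_1mod4 c k i = p -> walk_1mod4 c k i.+1 = q -> (i.+1 < 8 * k + 1)%N ->
      step p q = (true, z) ->
      exists2 i, (i.+1 < 8 * k + 1)%N & step (walk_1mod4 c k i) (walk_1mod4 c k i.+1) = (true, z).
    by move=> <- <-; exists i.
  have [n En] : exists n : nat, z = n%:Z by exists `|z|%N; lia.
  (* The ladder gives all sums but four: 2k and 2k + 2 occur at the bridge, 2k + 1 and 4k where the
     zigzags join the ladder. The sum 4k is the one lost by skipping the bridge vertex. *)
  have [En1|n1] := eqVneq n k.*2.
    by apply: (step_at c.-1 (true, n%:Z) (false, 0));
      [eval_walk..|lia|eval_step].
  have [En2|n2] := eqVneq n k.*2.+1.
    by apply: (step_at k.*2.+1 (false, k%:Z) (true, k.+1%:Z));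
      [eval_walk..|lia|eval_step].
  have [En3|n3] := eqVneq n k.*2.+2.
    by apply: (step_at c.-2 (false, 2) (true, (k.*2)%:Z));
      [eval_walk..|lia|eval_step].
  have [En4|n4] := eqVneq n (4 * k)%N.
    by apply: (step_at (6 * k).-1 (false, (3 * k)%N%:Z) (true, k%:Z));
      [eval_walk..|lia|eval_step].
  have [on|en] := boolP (odd n); have [lt_n|le_n] := ltnP n (4 * k).
  - by apply: (step_at n.-1 (true, (n./2)%:Z) (false, (n./2.+1)%:Z));
      [eval_walk..|lia|eval_step].
  - by apply: (step_at n.-2 (false, (n./2)%:Z) (true, (n./2.+1)%:Z));
      [eval_walk..|lia|eval_step].
  - by apply: (step_at n.-1 (false, (n./2)%:Z) (true, (n./2)%:Z));
      [eval_walk..|lia|eval_step].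
  - by apply: (step_at n.-2 (true, (n./2)%:Z) (false, (n./2)%:Z));
      [eval_walk..|lia|eval_step].
have [|[i [lt_i ni nj <-]]|[r [lt_r <-]]] := same_side_steps oc c2 ck z0 zc; first lia.
  by exists i; [lia | rewrite /walk_1mod4 (negPf ni) (negPf nj) lt_i (ltnW lt_i)].
exists (8 * k - r.+1)%N; first lia.
rewrite /walk_1mod4; do !(case: ifP => ?; try by exfalso; lia).
by rewrite /step /=; congr (_, inward c _ - inward c _); lia.
Qed.

Lemma walk_3mod4_outward (c k i : nat) : i != c.-1 -> (i <= k.*2)%N ->
  walk_3mod4 c k i = (false, outward c i).
Proof. by rewrite /walk_3mod4 => /negPf-> ->. Qed.

Lemma walk_3mod4_inward (c k r : nat) : (c < k)%N -> (r < k.*2)%N ->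
  walk_3mod4 c k (8 * k - 4 - r) = (true, inward c r).
Proof.
move=> ck rk; rewrite /walk_3mod4; do !(case: ifP => ?; try by exfalso; lia).
by congr (_, inward c _); lia.
Qed.

Lemma walk_3mod4_onto (c k : nat) (b : bool) (z : int) :
  odd c -> (2 < c)%N -> (c.+1 < k)%N -> - (3 * k).-1%:Z <= z < k%:Z ->
  (b, z) != (false, - (3 * k).-2%:Z) ->
  exists2 i, (i < 8 * k - 3)%N & walk_3mod4 c k i = (b, z).
Proof.
move=> oc c2 ck hz; rewrite xpair_eqE => ne_o.
have ck1 : (c < k.-1)%N by lia.
have [le_kz|lt_zk] : - k%:Z < z \/ z <= - k%:Z by lia.
  case: b {ne_o}.
    have [|r [le_r <-]] := inward_onto (z := z) oc c2 ck1; first lia.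
    by exists (8 * k - 4 - r)%N; rewrite ?walk_3mod4_inward //; lia.
  have [|i [lt_i ni <-]] := outward_onto (z := z) oc c2 ck1; first lia.
  by exists i; rewrite ?walk_3mod4_outward //; lia.
have [n En] : exists n : nat, z = - n%:Z by exists `|z|%N; lia.
case: b ne_o => /= ne_o.
  have [En1|n1] := eqVneq n k; first by visit (6 * k - 3)%N.
  have [En2|n2] := eqVneq n k.*2; first by visit c.-1.
  by have [lt_n|le_n] := ltnP n k.*2; [visit n.*2.-1 | visit (n.*2 - 3)%N].
by have [En1|n1] := eqVneq n (3 * k).-1; [visit (6 * k - 4)%N | visit n.*2].
Qed.

Lemma walk_3mod4_steps (c k : nat) (b : bool) (z : int) :
  odd c -> (2 < c)%N -> (c.+1 < k)%N ->
  (if b then - (6 * k - 2)%N%:Z <= z <= - (k.*2)%:Z else `|z| < (k.*2)%:Z) ->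
  (b, z) != (false, 0) -> (b, z) != (false, - (c.*2)%:Z) ->
  exists2 i, (i.+1 < 8 * k - 3)%N &
    step (walk_3mod4 c k i) (walk_3mod4 c k i.+1) \in [:: (b, z); (b, z + (4 * k).-1%:Z)].
Proof.
move=> oc c2 ck hz z0 zc; have ck1 : (c < k.-1)%N by lia.
have step_at i p q : walk_3mod4 c k i = p -> walk_3mod4 c k i.+1 = q -> (i.+1 < 8 * k - 3)%N ->
    step p q = (b, z) ->
    exists2 i, (i.+1 < 8 * k - 3)%N &
      step (walk_3mod4 c k i) (walk_3mod4 c k i.+1) \in [:: (b, z); (b, z + (4 * k).-1%:Z)].
  by move=> <- <- ? E; exists i; rewrite // inE E eqxx.
case: b hz z0 zc step_at => hz; rewrite !xpair_eqE /= => z0 zc step_at.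
  have [n En [hn1 hn2]] : exists2 n : nat, z = - n%:Z & (k.*2 <= n)%N /\ (n <= 6 * k - 2)%N.
    by exists `|z|%N; lia.
  move: step_at => {z0 zc hz ck1}; rewrite {}En => {z} step_at.
  have [En1|n1] := eqVneq n k.*2.
    by apply: (step_at c.-1 (true, - n%:Z) (false, 0));
      [eval_walk..|lia|eval_step].
  have [En2|n2] := eqVneq n (6 * k - 2)%N.
    by apply: (step_at (6 * k - 5)%N (true, - (3 * k).-1%:Z) (false, - (3 * k).-1%:Z));
      [eval_walk..|lia|eval_step].
  have [En3|n3] := eqVneq n (6 * k - 3)%N.
    (* The ladder loses this sum at the omitted vertex. The step from u^2 to the bridge has sum 2 -
       2k, which agrees with it modulo 4k - 1. *)
    exists c.-2; first lia.
    rewrite (_ : walk_3mod4 c k c.-2 = (false, 2)); last by eval_walk.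
    rewrite (_ : walk_3mod4 c k c.-2.+1 = (true, - (k.*2)%:Z)); last by eval_walk.
    by rewrite !inE /step !xpair_eqE /=; apply/orP; right; lia.
  have [En4|n4] := eqVneq n (4 * k).-1.
    by apply: (step_at (6 * k - 4)%N (false, - (3 * k).-1%:Z) (true, - k%:Z));
      [eval_walk..|lia|eval_step].
  have [on|en] := boolP (odd n); have [lt_n|le_n] := ltnP n (4 * k).
  - by move: n1 n2 n3 => _ _ _;
    apply: (step_at n.-1 (false, - (n./2)%:Z) (true, - (n./2.+1)%:Z));
      [eval_walk..|lia|eval_step].
  - by move: n1 n2 n4 => _ _ _;
    apply: (step_at n.-2 (true, - (n./2.+1)%:Z) (false, - (n./2)%:Z));
      [eval_walk..|lia|eval_step].
  - by move: n2 n3 n4 => _ _ _;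
    apply: (step_at n.-1 (true, - (n./2)%:Z) (false, - (n./2)%:Z));
      [eval_walk..|lia|eval_step].
  - by move: n1 n3 n4 => _ _ _;
    apply: (step_at n.-2 (false, - (n./2).-1%:Z) (true, - (n./2.+1)%:Z));
      [eval_walk..|lia|eval_step].
(* The zigzags of height k - 1 only reach differences up to 2k - 2; the two extreme ones use v u^-k
   and u^-k. *)
have [Ez|z1] := eqVneq z (k.*2.-1)%:Z.
  by apply: (step_at (6 * k - 3)%N (true, - k%:Z) (true, k.-1%:Z));
    [eval_walk..|lia|eval_step].
have [Ez|z2] := eqVneq z (- (k.*2.-1)%:Z).
  by apply: (step_at k.*2.-1%N (false, k.-1%:Z) (false, - k%:Z));
    [eval_walk..|lia|eval_step].
have [|[i [lt_i ni nj Ei]]|[r [lt_r Er]]] := same_side_steps oc c2 ck1 z0 zc; first lia.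
  apply: (step_at i (false, outward c i) (false, outward c i.+1)).
  - by apply: walk_3mod4_outward => //; lia.
  - by apply: walk_3mod4_outward => //; lia.
  - by lia.
  - by rewrite /step /= Ei.
apply: (step_at (8 * k - 4 - r.+1)%N (true, inward c r.+1) (true, inward c r)).
- by apply: walk_3mod4_inward; lia.
- by rewrite -(@walk_3mod4_inward c k r); [congr (walk_3mod4 c k _); lia | lia..].
- by lia.
- by rewrite /step /= Er.
Qed.

(* m = 2k + 1; the vertex u^-k is omitted, and u^-k is the missing step.  The
   ladder 0, 0, 1, 1, ..., k, k joins a zigzag of rotations, read backwards
   from 0, -(k-1), -1, -(k-2), ..., to the zigzag k, 2k, k+1, 2k-1, ... of
   reflections. *)
Definition walk_coprime (k i : nat) : bool * int :=
  if (i < k)%N then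
    (false, if odd (k.-1 - i) then (k.-1 - i)./2%:Z - k.-1%:Z
            else - (k.-1 - i)./2%:Z)
  else if (i <= 3 * k)%N then
    (~~ odd (i - k), (uphalf (i - k))%:Z)
  else
    (true, if odd (i - 3 * k) then k.*2%:Z - (i - 3 * k)./2%:Z
           else k%:Z + (i - 3 * k)./2%:Z).

Ltac eval_walk0 :=
  rewrite /walk_coprime /=; repeat (case: ifP => ?; try by exfalso; lia); congr pair; lia.
Ltac visit0 j := exists j; [lia | eval_walk0].

Lemma walk_coprime_onto (k : nat) (b : bool) (z : int) : (0 < k)%N ->
  (if b then 0 <= z <= (k.*2)%:Z else `|z| <= k%:Z) ->
  (b, z) != (false, - k%:Z) -> exists2 i, (i < 4 * k + 1)%N & walk_coprime k i = (b, z).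
Proof.
move=> k0 hz; rewrite xpair_eqE => ne_o.
have [n En] : exists n : nat, z = n%:Z \/ z = - n%:Z /\ (0 < n)%N.
  by exists `|z|%N; lia.
case: b hz ne_o => /= hz ne_o.
  have {}En : z = n%:Z by lia.
  have [le_n|lt_n] := leqP n k; first by visit0 (k + n.*2)%N.
  have [le_n3|lt_n3] := leqP n.*2 (3 * k); first by visit0 (3 * k + (n - k).*2)%N.
  by visit0 (3 * k + (k.*2 - n).*2.+1)%N.
case: En => [En|[En n0]].
  by have [n0|n0] := posnP n; [visit0 k.-1 | visit0 (k + n.*2.-1)%N].
have [lt_n|le_n] := ltnP n.*2 k; first by visit0 (k.-1 - n.*2)%N.
by visit0 (k.-1 - (k.-1 - n).*2.+1)%N.
Qed.
Lemma walk_coprime_steps (k : nat) (b : bool) (z : int) : (0 < k)%N ->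
  (if b then 0 <= z <= (k.*2)%:Z else `|z| <= k%:Z) ->
  (b, z) != (false, 0) -> (b, z) != (false, - k%:Z) ->
  exists2 i, (i.+1 < 4 * k + 1)%N & step (walk_coprime k i) (walk_coprime k i.+1) = (b, z).
Proof.
move=> k0 hz z0 zk.
have step_at i p q : walk_coprime k i = p -> walk_coprime k i.+1 = q -> (i.+1 < 4 * k + 1)%N ->
    step p q = (b, z) ->
    exists2 i, (i.+1 < 4 * k + 1)%N & step (walk_coprime k i) (walk_coprime k i.+1) = (b, z).
  by move=> <- <-; exists i.
have [n En] : exists n : nat, z = n%:Z \/ z = - n%:Z /\ (0 < n)%N.
  by exists `|z|%N; lia.
case: b hz z0 zk step_at => hz; rewrite !xpair_eqE /= => z0 zk step_at.
  have {}En : z = n%:Z by lia.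
  have hn : (n <= k.*2)%N by lia.
  move: step_at => {z0 zk hz}; rewrite {}En => {z} step_at.
  have [n0|n0] := posnP n.
    by apply: (step_at k.-1 (false, 0) (true, 0));
      [eval_walk0..|lia|eval_step].
  have [on|en] := boolP (odd n).
    by apply: (step_at (k + n).-1 (true, (n./2)%:Z) (false, (n./2.+1)%:Z));
      [eval_walk0..|lia|eval_step].
  by apply: (step_at (k + n).-1 (false, (n./2)%:Z) (true, (n./2)%:Z));
    [eval_walk0..|lia|eval_step].
(* Counted by [j] away from the ladder, both zigzags make steps of length k - j, with opposite
   signs. For j = 0 only the reflections have one, and -k is the missing step. *)
have [j [jk Ej]] : exists j, (j < k)%N /\ `|z|%N = (k - j)%N by exists (k - n)%N; lia.
have [oj|ej] := boolP (odd j); case: En => [En|[En n0]].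
- by apply: (step_at (k.-1 - j)%N (false, j./2%:Z - k.-1%:Z) (false, - (j./2)%:Z));
    [eval_walk0..|lia|eval_step].
- by apply: (step_at (3 * k + j)%N (true, k.*2%:Z - j./2%:Z) (true, k%:Z + j./2.+1%:Z));
    [eval_walk0..|lia|eval_step].
- by apply: (step_at (3 * k + j)%N (true, k%:Z + j./2%:Z) (true, k.*2%:Z - j./2%:Z));
    [eval_walk0..|lia|eval_step].
- by apply: (step_at (k.-1 - j)%N (false, - (j./2)%:Z) (false, j./2%:Z - k%:Z));
    [eval_walk0..|lia|eval_step].
Qed.

Lemma walk_1mod4_covers (c k : nat) : odd c -> (2 < c)%N -> (c < k)%N ->
  covers_vertices (4 * k).+1 (walk_1mod4 c k) (false, k.+1%:Z) /\
  covers_steps (4 * k).+1 (walk_1mod4 c k) (- (c.*2)%:Z).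
Proof.
move=> oc c2 ck; have En : (4 * k).+1.*2.-1 = (8 * k + 1)%N by lia.
split=> b; rewrite En.
  by exists (- k%:Z) => z hz; apply: walk_1mod4_onto; rewrite //; lia.
exists (if b then (k.*2)%:Z else - (k.*2)%:Z) => z hz z0 zc.
have [|i lt_i E] := walk_1mod4_steps oc c2 ck _ z0 zc; first by case: b hz {z0 zc}; lia.
by exists i; rewrite // inE E eqxx.
Qed.

Lemma walk_3mod4_covers (c k : nat) : odd c -> (2 < c)%N -> (c.+1 < k)%N ->
  covers_vertices (4 * k).-1 (walk_3mod4 c k) (false, - (3 * k).-2%:Z) /\
  covers_steps (4 * k).-1 (walk_3mod4 c k) (- (c.*2)%:Z).
Proof.
move=> oc c2 ck; have En : (4 * k).-1.*2.-1 = (8 * k - 3)%N by lia.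
split=> b; rewrite En.
  by exists (- (3 * k).-1%:Z) => z hz; apply: walk_3mod4_onto; rewrite //; lia.
exists (if b then - (6 * k - 2)%N%:Z else - (k.*2.-1)%:Z) => z hz z0 zc.
by apply: walk_3mod4_steps; rewrite //; case: b hz {z0 zc}; lia.
Qed.

Lemma walk_coprime_covers (k : nat) : (0 < k)%N ->
  covers_vertices k.*2.+1 (walk_coprime k) (false, - k%:Z) /\
  covers_steps k.*2.+1 (walk_coprime k) (- k%:Z).
Proof.
move=> k0; have En : k.*2.+1.*2.-1 = (4 * k + 1)%N by lia.
split=> b; rewrite En; exists (if b then 0 else - k%:Z) => z hz.
  by apply: walk_coprime_onto; rewrite //; case: b hz; lia.
move=> z0 zk; have [|i lt_i E] := walk_coprime_steps k0 _ z0 zk; first by case: b hz {z0 zk}; lia.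
by exists i; rewrite // inE E eqxx.
Qed.

End Walks.

(** * Back to the dihedral group *)

Lemma omitted_element (m : nat) (S : {set 'D_(m.*2)}) :
  1 < m -> 1%g \notin S -> #|S| = m.*2 - 2 ->
  exists2 x : 'D_(m.*2), x != 1%g & x \notin S.
Proof.
move=> m1 S1 cardS; have cardD : #|'D_(m.*2)| = m.*2 by rewrite -cardsT card_dihedral.
have cardC : #|~: S| = 2 by rewrite cardsCs setCK cardS cardD; lia.
have : 0 < #|~: S :\ 1%g|.
  by move: cardC; rewrite (cardsD1 1%g) inE S1 add1n => -[->].
by case/card_gt0P=> x; rewrite !inE => /andP[x1 xS]; exists x.
Qed.

Lemma has_S_sequencing_of_covering_walk (m d e : nat) (w : nat -> bool * int)
    (o : bool * int) (z : int) (S : {set 'D_(m.*2)}) :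
  odd m -> 1 < m -> covers_vertices m w o -> covers_steps m w z ->
  (e%:Z = z %[mod m])%Z -> gcdn m e = d ->
  1%g \notin S -> #|S| = m.*2 - 2 ->
  (forall x : 'D_(m.*2), x != 1%g -> x \notin S -> #[x]%g * d = m) ->
  has_S_sequencing S.
Proof.
move=> om m1 covV covS ez ed S1 cardS ordS.
have [u [v [ou v2 uv gen]]] := dihedral_generators m1.
have [x x1 xS] := omitted_element m1 S1 cardS.
have ox := ordS x x1 xS.
(* A reflection squares to 1, whereas the order of [x] divides the odd number [m]. *)
have xu : x \in <[u]>%g.
  have [[] [i xE]] := gen x; last by rewrite xE expg0 mul1g mem_cycle.
  have x2 : (x ^+ 2 = 1)%g.
    rewrite expgS expg1 xE expg1 -mulgA (mulgA (u ^+ i)%g) (conjgC (u ^+ i)%g) conjXg uv.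
    by rewrite expgVn !mulgA -expg2 v2 mul1g mulVg.
  have : #[x]%g %| 2 by rewrite order_dvdn x2.
  rewrite dvdn_divisors // !inE order_eq1 (negPf x1) /= => /eqP o2.
  by have := om; rewrite -[X in odd X]ox oddM o2.
have [||s cs xE] := @expg_coprime_lift _ u x e d xu; rewrite ?ou //.
have us : (<[u ^+ s]> = <[u]>)%g.
  by apply/esym/eqP; rewrite -/(generator _ _) generator_coprime coprime_sym.
have usm : ((u ^+ s) ^+ m = 1)%g.
  have um : (u ^+ m = 1)%g by apply/eqP; rewrite -order_dvdn ou.
  by rewrite -expgM mulnC expgM um expg1n.
apply: (@has_S_sequencing_of_walk _ (u ^+ s)%g v m) covV covS _ _ => //.
- exact: ltnW.
- by rewrite conjXg uv expgVn.
- move=> g; have [b [i ->]] := gen g.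
  have /cycleP[j ->] : (u ^+ i \in <[u ^+ s]>)%g by rewrite us mem_cycle.
  by exists b, j.
- by rewrite -cardsT card_dihedral.
move=> g gS; split; first by apply: contraNneq S1 => <-.
by apply: contraNneq xS => gx; rewrite xE -(upowE usm ez) -gx.
Qed.

(* 'D_(m.*2) is MathComp's dihedral group of order 2m (extremal.v). *)
Theorem theorem5p10 (d : nat) (hd : 0 < d) :
  exists M : nat, forall m : nat, M < m ->
    (m %% 8 = 5 \/ m %% 8 = 7) ->
    forall S : {set 'D_(m.*2)},
      (1%g \notin S) -> #|S| = m.*2 - 2 ->
      (forall x : 'D_(m.*2), x != 1%g -> x \notin S -> #[x]%g * d = m) ->
      has_S_sequencing S.
Proof.
(* This bound puts k above d + 1 in both ladder constructions with d > 1. *)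
exists (8 * d + 8) => m lt_m m8 S S1 cardS ordS.
have om : odd m by lia.
have m1 : 1 < m by lia.
have [d1|d1] := eqVneq d 1.
  have [k Em] : exists k, m = k.*2.+1 by exists m./2; lia.
  subst m; have [|covV covS] := @walk_coprime_covers k; first lia.
  apply: (has_S_sequencing_of_covering_walk (e := k.+1)) covV covS _ _ S1 cardS ordS => //.
    by apply/eqP; rewrite eqz_mod_dvd; apply/dvdzP; exists 1%R; lia.
  by rewrite d1 -addnn -addSn gcdnC gcdnDl; apply/eqP; rewrite -/(coprime _ _) coprimeSn.
have [x x1 /(ordS x x1) ox] := omitted_element m1 S1 cardS.
have od : odd d by move: om; rewrite -ox oddM => /andP[].
have d3 : 2 < d by lia.
(* The natural number m - 2d stands for the avoided step -2d; since [m] is odd, the gcd reduces to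
   that of [m] and [d]. *)
have gd : gcdn m (m - d.*2) = d.
  have d2m : d.*2 <= m by lia.
  have dm : d %| m by rewrite -ox dvdn_mull.
  rewrite gcdnC -{2}(subnK d2m) gcdnDl gcdnC -(gcdnDr d.*2 (m - d.*2)).
  rewrite subnK // gcdnC -muln2 Gauss_gcdl ?coprimen2 //; exact/gcdn_idPr.
have ez : ((m - d.*2)%N%:Z = - (d.*2)%:Z %[mod m])%Z.
  by apply/eqP; rewrite eqz_mod_dvd; apply/dvdzP; exists 1%R; lia.
have [m1'|m3] : m %% 4 = 1 \/ m %% 4 = 3 by lia.
  have [k Em] : exists k, m = (4 * k).+1 by exists (m %/ 4); lia.
  subst m; have [|covV covS] := @walk_1mod4_covers d k od d3; first lia.
  exact: (has_S_sequencing_of_covering_walk om m1 covV covS ez gd S1 cardS ordS).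
have [k Em] : exists k, m = (4 * k).-1 by exists (m %/ 4).+1; lia.
subst m; have [|covV covS] := @walk_3mod4_covers d k od d3; first lia.
exact: (has_S_sequencing_of_covering_walk om m1 covV covS ez gd S1 cardS ordS).
Qed.
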